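(* Let $G$ be a finite transitive permutation group of degree $n$ and let $G_x$ be a point stabiliser. Then $\big|\mathrm{Comp}_A(G_x)\big| < 2(\log n)^2$.
   Context: For a finite group $H$, $\mathrm{Comp}_A(H)$ denotes the set of isomorphism types of abelian composition factors of $H$ (i.e. the cyclic groups of prime order occurring as composition factors of $H$). $\log$ denotes the logarithm to base 2.
   Formalization: The degree n is assumed to be at least 2, since for n = 1 the stated strict inequality reads 0 < 0 and is false. *)

(* Defs.v *)
From Stdlib Require Import Reals.
From mathcomp Require Import all_boot all_fingroup all_solvable.
From mathcomp Require Import boolp.

Set Implicit Arguments.
Unset Strict Implicit.
Unset Printing Implicit Defensive.

(* [has_abelian_comp_factor H p] : some composition series of H (in the sense
   of MathComp's [comps], a maximal-normal series H > s_1 > ... > 1) has a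
   factor B/A (consecutive terms) which is abelian of order p.  Since
   composition factors are simple, such p is prime and B/A ~= C_p; so these
   p are exactly the isomorphism types in Comp_A(H). *)
Definition has_abelian_comp_factor (gT : finGroupType) (H : {group gT})
    (p : nat) : Prop :=
  exists s : seq {group gT}, comps H s /\
    exists2 i, (i < size s)%N &
      let B := nth H (H :: s) i in
      let A := nth H (H :: s) i.+1 in
      abelian (B / A)%g /\ #|(B / A)%g| = p.

(* Comp_A(H), indexed by the prime order p of the factor.  Every such p
   divides #|H|, so indexing by 'I_(#|H|.+1) loses nothing. *)
Definition CompA (gT : finGroupType) (H : {group gT}) : {set 'I_(#|H|.+1)} :=
  [set p : 'I_(#|H|.+1) | `[< has_abelian_comp_factor H p >]].

Definition log2 (x : R) : R := Rdiv (ln x) (ln 2).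

(* Main.v *)
Require Import Defs.
From Stdlib Require Import Reals Lra.
From mathcomp Require Import all_boot all_fingroup all_solvable.
From mathcomp Require Import boolp.

Set Implicit Arguments.
Unset Strict Implicit.
Unset Printing Implicit Defensive.

Local Open Scope group_scope.

(* For a prime q let R_q(X) be the smallest normal subgroup of X whose quotient
   has no composition factor of order q.  If R_q(G) = R_q(H) with H core-free in
   G, then R_q(H) = 1, so H has no composition factor of order q.  By induction
   on |G : H|, the equality R_q(G) = R_q(H) holds for every odd prime q outside
   a set of at most (log |G : H|)^2 primes.  As this equality is transitive, the
   crux is a maximal subgroup H; let K be its core and N/K a chief factor of G.
   - If some t outside H has its square in H, then t normalises
     J = H :&: H^t, so R_q(H) = R_q(J) is normal in G = <H, t>; then
     R_q(G) = R_q(H), unless N/K is an abelian q-group.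
   - If N/K is abelian of odd order, take J to be the stabiliser in H of a pair
     {v, v^-1} in N/K: its index is at most |G : H| / 2, and R_q(H) <= J forces
     R_q(H) to be normal in G.  Only the prime dividing |N/K| is lost.
   - If all 2-elements of G lie in H, then no nontrivial suborbit is self-paired,
     so |H : H :&: H^g| < |G : H| / 2, and one bounds the set of all primes
     dividing the order of G modulo the core: the q-elements of H generate a
     normal subgroup of G as soon as they lie in H :&: H^g. *)

(** * Subnormal subgroups and the residual R_q *)

Lemma subnormalY (gT : finGroupType) (A N G : {group gT}) :
  A <|<| G -> N <| G -> A <*> N <|<| G.
Proof.
case/subnormalP=> s sAG <- {G}.
elim: s A sAG => [|B s IHs] A /= => [_ nNA | /andP[/andP[sAB nAB] sB] nNG].
  by rewrite (joing_idPl (normal_sub nNA)) subnormal_refl.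
apply: subnormal_trans (IHs B sB nNG); apply: normal_subnormal.
have sBG: B \subset last B s by apply: subnormal_sub; apply/subnormalP; exists s.
have nNB: B \subset 'N(N) := subset_trans sBG (normal_norm nNG).
rewrite /normal genS ?setSU //= join_subG; apply/andP; split.
  exact: normsY.
by rewrite (subset_trans (joing_subr A N)) ?normG.
Qed.

(** For prime [q] this means that every simple quotient of [A] has order [q]; the trivial group
    qualifies vacuously. *)
Definition qtop (gT : finGroupType) (q : nat) (A : {set gT}) :=
  [forall B : {group gT}, (B <| A) && (B \proper A) ==>
    [exists C : {group gT}, [&& C <| A, B \subset C & #|A : C| == q]]].

Lemma qtopP (gT : finGroupType) q (A : {group gT}) :
  reflect (forall B : {group gT}, B <| A -> B \proper A ->
             exists C : {group gT}, [/\ C <| A, B \subset C & #|A : C| = q])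
          (qtop q A).
Proof.
apply: (iffP forallP) => qA B.
  move=> nBA pBA; have:= qA B; rewrite nBA pBA /= => /existsP[C /and3P[? ? /eqP]].
  by exists C.
apply/implyP=> /andP[nBA pBA]; have [C [nCA sBC iC]] := qA B nBA pBA.
by apply/existsP; exists C; rewrite nCA sBC iC /=.
Qed.

Lemma qtopJ (gT : finGroupType) q (A : {group gT}) x : qtop q A -> qtop q (A :^ x).
Proof.
move/qtopP=> qA; apply/qtopP=> B nBA pBA.
have [||C [nCA sBC iC]] := qA (B :^ x^-1)%G.
- by rewrite -(normalJ _ _ x) /= conjsgKV.
- by rewrite -(properJ _ _ x) /= conjsgKV.
exists (C :^ x)%G; split; first by rewrite /= normalJ.
  by rewrite -(conjSg _ _ x^-1) /= conjsgK.
by rewrite /= indexJg.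
Qed.

(* For a prime q, this is the smallest normal subgroup of G whose quotient has no
   composition factor of order q; generating it by subnormal subgroups makes its
   monotonicity and idempotence immediate. *)
Definition resid (gT : finGroupType) (q : nat) (G : {set gT}) : {set gT} :=
  <<\bigcup_(A : {group gT} | (A <|<| G) && qtop q A) A>>.

Canonical resid_group (gT : finGroupType) q (G : {set gT}) :=
  Eval hnf in [group of @resid gT q G].

Section Residual.

Variables (gT : finGroupType) (q : nat).
Implicit Types A B G H K M N J : {group gT}.

Lemma sub_resid A G : A <|<| G -> qtop q A -> A \subset resid q G.
Proof. by move=> sAG qA; apply: sub_gen; apply: (bigcup_max A); rewrite ?sAG. Qed.

Lemma resid_subP G (X : {group gT}) :
  reflect (forall A, A <|<| G -> qtop q A -> A \subset X) (resid q G \subset X).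
Proof.
apply: (iffP idP) => [sRX A sAG qA | sAX].
  exact: subset_trans (sub_resid sAG qA) sRX.
by rewrite gen_subG; apply/bigcupsP=> A /andP[sAG qA]; apply: sAX.
Qed.

Lemma resid_sub G : resid q G \subset G.
Proof. by apply/resid_subP=> A /subnormal_sub. Qed.

Lemma subnormalJ A G x : A <|<| G -> A :^ x <|<| G :^ x.
Proof.
case/subnormalP=> s sAG <-; elim: s A sAG => [|B s IHs] A /=.
  by move=> _; apply: (subnormal_refl (A :^ x)%G).
case/andP=> nAB /IHs; apply: (@subnormal_trans _ (B :^ x)%G (A :^ x)%G).
by apply: normal_subnormal; rewrite /= normalJ.
Qed.

Lemma residJ_sub G x : resid q G :^ x \subset resid q (G :^ x).
Proof.
rewrite sub_conjg; apply/(@resid_subP _ (resid q (G :^ x) :^ x^-1)%G) => A sAG qA.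
rewrite -sub_conjg; apply: (@sub_resid (A :^ x)%G (G :^ x)%G).
  exact: subnormalJ.
exact: qtopJ.
Qed.

Lemma residJ G x : resid q (G :^ x) = resid q G :^ x.
Proof.
apply/eqP; rewrite eqEsubset residJ_sub andbT -sub_conjgV.
by apply: subset_trans (residJ_sub _ _) _; rewrite /= conjsgK.
Qed.

Lemma norm_resid G : 'N(G) \subset 'N(resid q G).
Proof. by apply/subsetP=> x /normP nGx; rewrite inE -residJ nGx. Qed.

Lemma resid_normal G : resid q G <| G.
Proof. by rewrite /normal resid_sub (subset_trans (normG G) (norm_resid G)). Qed.

Lemma resid_subnormal N G : N <|<| G -> resid q N \subset resid q G.
Proof.
move=> sNG; apply/resid_subP=> A sAN; apply: sub_resid.
exact: subnormal_trans sAN sNG.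
Qed.

(** A generator [A] of R_q(G) lies in [N], so [A = A :&: N] is subnormal in [N]. *)
Lemma sub_resid_resid G N : resid q G \subset N -> N \subset G ->
  resid q G \subset resid q N.
Proof.
move=> sRN sNG; apply/resid_subP=> A sAG qA; apply: sub_resid (qA).
rewrite -(setIidPl (subset_trans (sub_resid sAG qA) sRN)).
exact: setI_subnormal sNG sAG.
Qed.

(** R_q(H) is its own residual; once it is normal in [G], its generators are subnormal in [G] and
    hence lie in R_q(G). *)
Lemma resid_eq_of_norm G H : H \subset G -> resid q G \subset H ->
  G \subset 'N(resid q H) -> resid q G = resid q H.
Proof.
move=> sHG sRH nRG; apply/eqP; rewrite eqEsubset sub_resid_resid //=.
apply: subset_trans (sub_resid_resid (subxx _) (resid_sub H)) _ => /=.
apply: resid_subnormal; apply: normal_subnormal.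
by rewrite /normal nRG (subset_trans (resid_sub H)).
Qed.

(** Among the subnormal subgroups of [G] with a normal subgroup of index [q], a minimal one
    satisfies [qtop q], so R_q(G) contains it. *)
Lemma resid_ntriv A B G : prime q -> A <|<| G -> B <| A -> #|A : B| = q ->
  resid q G :!=: 1.
Proof.
move=> q_pr sAG nBA iBA.
pose P (X : {group gT}) :=
  (X <|<| G) && [exists Y : {group gT}, (Y <| X) && (#|X : Y| == q)].
have PA: P A by rewrite /P sAG; apply/existsP; exists B; rewrite nBA iBA /=.
have [X /mingroupP[/andP[sXG /existsP[Y /andP[nYX /eqP iYX]]] minX] _] :=
  mingroup_exists PA.
(* By minimality of X, its normal subgroup Y of index q contains every proper
   normal subgroup M: otherwise M :&: Y has index q in M. *)
have qX: qtop q X.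
  apply/qtopP=> M nMX pMX; exists Y; split=> //.
  apply/idPn=> nsMY; have sMX := normal_sub nMX.
  have nMXs: M <|<| G := subnormal_trans (normal_subnormal nMX) sXG.
  have nI: M :&: Y <| M.
    by rewrite /normal subsetIl normsI ?normG // (subset_trans sMX) // normal_norm.
  have sMYX: Y * M = X.
    have nY: M \subset 'N(Y) := subset_trans sMX (normal_norm nYX).
    apply/eqP; rewrite -norm_joinEr // joingC eqEsubset join_subG sMX normal_sub //=.
    rewrite -indexg_eq1.
    have: #|X : M <*> Y| %| q.
      by rewrite -iYX indexgS // joing_subr.
    case/primeP: q_pr => _ h /h /orP[//|/eqP e].
    case/negP: nsMY; have/eqP := e; rewrite -iYX => /eqP eq_i.
    have eMY: M <*> Y = Y.
      apply/esym/eqP; rewrite eqEcard joing_subr /=.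
      have sJ: M <*> Y \subset X by rewrite join_subG sMX normal_sub.
      have := Lagrange sJ; rewrite -(Lagrange (normal_sub nYX)) /= eq_i.
      by move/eqP; rewrite eqn_pmul2r ?indexg_gt0 // => /eqP->.
    by rewrite -eMY joing_subl.
  suffices PM: P M by have := minX M PM sMX => eM; rewrite eM properxx in pMX.
  rewrite /P nMXs; apply/existsP; exists (M :&: Y)%G; rewrite nI /=.
  by rewrite indexgI -indexMg sMYX iYX.
apply/eqP=> R1; have:= sub_resid sXG qX; rewrite R1 subG1 => /eqP X1.
have := prime_gt1 q_pr; rewrite -iYX X1.
by rewrite (eqP (_ : #|1 : Y| == 1)%N) // indexg_eq1 sub1G.
Qed.

Lemma qtop_sub A B : qtop q A -> B <| A -> ~~ (q %| #|A : B|) -> A \subset B.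
Proof.
move=> /qtopP qA nBA; apply: contraR => nsAB.
have pBA: B \proper A by rewrite properE normal_sub.
by have [C [_ sBC <-]] := qA B nBA pBA; apply: indexgS.
Qed.

(** In a generator [A] of the residual, the [q]-elements generate a normal subgroup of index prime
    to [q], which is [A] itself by [qtop_sub]. *)
Lemma resid_gen_pelt G : prime q ->
  resid q G \subset <<[set x in resid q G | q.-elt x]>>.
Proof.
move=> q_pr; apply: subset_trans (sub_resid_resid (subxx _) (resid_sub G)) _ => /=.
apply/(resid_subP _ <<[set x in resid q G | q.-elt x]>>) => A sAR qA.
have sAR' := subnormal_sub sAR.
suffices sAS: A \subset <<[set x in A | q.-elt x]>>.
  apply: subset_trans sAS (genS _); apply/subsetP=> x /[!inE] /andP[Ax ->].
  by rewrite (subsetP sAR').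
apply: qtop_sub qA _ _ => /=.
  rewrite /normal gen_subG; apply/andP; split.
    by apply/subsetP=> x /[!inE] /andP[].
  apply: norms_gen; apply/subsetP=> x Ax; rewrite inE.
  by apply/subsetP=> _ /imsetP[y /[!inE] /andP[Ay qy] ->]; rewrite groupJ // p_eltJ.
have [P /and3P[sPA qP q'P]] := Sylow_exists q A.
rewrite p'natE // in q'P; apply: contra q'P => /dvdn_trans; apply.
apply: indexgS; apply: sub_gen; apply/subsetP=> x Px.
by rewrite inE (subsetP sPA) // (mem_p_elt qP).
Qed.

(** G/N is isomorphic to H/(H :&: N). For a generator [A] of R_q(G), a minimal subnormal [X] of [H]
    with [N * X = N * A] inherits [qtop q], so it lies in R_q(H). *)
Lemma resid_mul G H N : N <| G -> H \subset G -> N * H = G ->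
  resid q G \subset N * resid q H.
Proof.
move=> nNG sHG defG.
have nN (X : {set gT}) : X \subset G -> X \subset 'N(N).
  by move=> sXG; apply: subset_trans sXG (normal_norm nNG).
have nNR: resid q H \subset 'N(N) by rewrite nN // (subset_trans (resid_sub H)).
rewrite -norm_joinEr //; apply/(@resid_subP _ (N <*> resid q H)) => A sAG qA.
have sAGs := subnormal_sub sAG.
pose P (X : {group gT}) := (X <|<| H) && (N * X == N * A).
(* The modular law and [N * H = G] provide a first candidate for [X]. *)
have PX0: P ((A <*> N) :&: H)%G.
  rewrite /P (setI_subnormal sHG (subnormalY sAG nNG)) /=.
  rewrite setIC group_modl ?joing_subr // defG /= joingC norm_joinEr ?nN //.
  by apply/eqP; apply/setIidPr; rewrite mul_subG // normal_sub.
have [X /mingroupP[/andP[sXH /eqP eX] minX] _] := mingroup_exists PX0.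
have sXG: X \subset G := subset_trans (subnormal_sub sXH) sHG.
suffices qX: qtop q X.
  rewrite /= norm_joinEr //; apply: (subset_trans (mulG_subr N A)).
  by rewrite -eX mulgS // sub_resid.
apply/qtopP=> B nBX pBX.
have sBX := normal_sub nBX; have sBG := subset_trans sBX sXG.
(* Minimality of [X]: a proper normal subgroup of [X] covers less of N * A / N. *)
have neB: ~~ (N * A \subset N * B).
  apply: contraL pBX => sAB.
  suffices PB: P B by rewrite -{1}(minX B) // properxx.
  rewrite /P (subnormal_trans (normal_subnormal nBX)) // eqEsubset sAB andbT.
  by rewrite -eX mulgS.
have nNY C D : C <| D -> D \subset G -> N <*> C <| N <*> D.
  case/andP=> sCD nCD sDG; rewrite /normal genS ?setUS // join_subG.
  by rewrite (subset_trans (joing_subl N C)) ?normG //= normsY // nN.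
have eXY: N <*> X = N <*> A by rewrite !norm_joinEr ?nN.
have nE: (N <*> B) :&: A <| A.
  have:= nNY _ _ nBX sXG; rewrite eXY => /andP[_ nBA].
  rewrite /normal subsetIr normsI ?normG //.
  exact: subset_trans (joing_subr N A) nBA.
have pE: (N <*> B) :&: A \proper A.
  rewrite properE subsetIr /= subsetI subxx andbT; apply: contra neB.
  by rewrite norm_joinEr ?nN // => /(mulgS N); rewrite mulgA mulGid.
have [C [nCA sEC iC]] := qtopP _ _ qA _ nE pE.
have sCA := normal_sub nCA; have sCG := subset_trans sCA sAGs.
have nCX: N <*> C <| N <*> X by rewrite eXY nNY.
(* X / (X :&: NC), NA / NC and A / C are isomorphic, since [C] contains [A :&: N]. *)
exists (X :&: (N <*> C))%G; split.
- rewrite /normal subsetIl normsI ?normG //.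
  exact: subset_trans (joing_subr N X) (normal_norm nCX).
- rewrite /= subsetI sBX norm_joinEr ?nN //=.
  apply: subset_trans (mulgS N sEC); rewrite /= setIC.
  rewrite group_modl ?joing_subl // subsetI joing_subr andbT -eX.
  exact: subset_trans sBX (mulG_subr _ _).
have absorb (Y : {set gT}) : Y \subset G -> (N <*> C) * Y = C * (N * Y).
  by move=> sYG; rewrite norm_joinEr ?nN // -(normC (nN _ sCG)) -mulgA.
rewrite /= indexgI -indexMg absorb // eX -absorb // indexMg -indexgI -iC.
congr #|_ : _|; apply/eqP; rewrite eqEsubset subsetI sCA joing_subr !andbT.
rewrite /= norm_joinEr ?nN // -(normC (nN _ sCG)) setIC -group_modl //.
by rewrite mul_subG // (subset_trans _ sEC) // setSI // joing_subl.
Qed.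

(** Let [M] be a maximal proper normal subgroup containing [K]. Some generator [A] of R_q(G) is not
    inside [M]; then G = MA, and the simple group G/M is a quotient of [A], so it has order [q]. *)
Lemma resid_normal_index G K : prime q -> K <| G -> G \subset resid q G * K ->
  K \proper G -> exists M : {group gT}, [/\ M <| G, K \subset M & #|G : M| = q].
Proof.
move=> q_pr nKG sGRK pKG.
pose P M := (M <| G) && (M \proper G).
have PK: P K by rewrite /P nKG.
have [M /maxgroupP[/andP[nMG pMG] maxM] sKM] := maxgroup_exists PK.
exists M; split=> //.
have nsRM: ~~ (resid q G \subset M).
  apply: contra (proper_subn pMG) => sRM.
  by rewrite (subset_trans sGRK) // mul_subG.
have [A [sAG qA nsAM]]: exists A : {group gT},
    [/\ A <|<| G, qtop q A & ~~ (A \subset M)].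
  have [A /and3P[? ? ?]|noA] := pickP (fun A : {group gT} =>
    [&& A <|<| G, qtop q A & ~~ (A \subset M)]); first by exists A.
  case/negP: nsRM; apply/resid_subP=> A sAG qA.
  by have:= noA A; rewrite sAG qA /= => /negbFE.
have sMG := normal_sub nMG; have sAGs := subnormal_sub sAG.
have nM (X : {set gT}) : X \subset G -> X \subset 'N(M).
  by move=> sXG; apply: subset_trans sXG (normal_norm nMG).
have maxM' (X : {group gT}) : X <| G -> M \subset X -> X != G :> {set gT} -> X :=: M.
  move=> nXG sMX neXG; apply: maxM sMX.
  by rewrite /P nXG properEneq neXG normal_sub.
have eMA: M <*> A = G.
  have sMA: M <*> A <|<| G by rewrite joingC; apply: subnormalY.
  case: (subnormalEr sMA) => [//|[X [sMAX nXG pXG]]].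
  have sMAX' := subnormal_sub sMAX.
  case/negP: nsAM; rewrite -(maxM' X) //; last by rewrite proper_neq.
    exact: subset_trans (joing_subr M A) sMAX'.
  exact: subset_trans (joing_subl M A) sMAX'.
have nI: M :&: A <| A by rewrite /normal subsetIr normsI ?normG ?nM.
have pI: M :&: A \proper A by rewrite properE subsetIr subsetI subxx andbT.
have [C [nCA sIC iC]] := qtopP _ _ qA _ nI pI.
have sCA := normal_sub nCA; have sCG := subset_trans sCA sAGs.
have nMCG: M <*> C <| G.
  rewrite -eMA /normal genS ?setUS //= join_subG.
  rewrite (subset_trans (joing_subl M C)) ?normG //=.
  by rewrite normsY ?nM // normal_norm.
have eMC: M <*> C = M.
  apply: (maxM' (M <*> C)%G nMCG (joing_subl _ _)) => /=.
  apply/eqP=> eMC; have := prime_gt1 q_pr; rewrite -iC.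
  suffices sAC: A \subset C by rewrite (eqP (_ : #|A : C| == 1)%N) // indexg_eq1.
  have: A \subset C * M by rewrite normC ?nM // -norm_joinEr ?nM // eMC.
  by move/setIidPr; rewrite -group_modl // => <-; rewrite mul_subG.
rewrite -eMA norm_joinEr ?nM // indexMg -indexgI -iC.
congr #|_ : _|; apply/eqP; rewrite eqEsubset setIC sIC subsetI sCA /= andbT.
by rewrite -eMC joing_subr.
Qed.

End Residual.

(** * Chief factors above the core of a maximal subgroup *)

Lemma chief_exists (gT : finGroupType) (G K : {group gT}) : K <| G -> K \proper G ->
  exists N : {group gT}, [/\ N <| G, K \proper N & minnormal (N / K) (G / K)].
Proof.
move=> nKG pKG; have nKG' := normal_norm nKG.
have ntGK: G / K != 1.
  by rewrite -subG1 quotient_sub1 // proper_subn.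
have [M minM sMG] := minnormal_exists ntGK (normG _).
have [/andP[ntM nM] _] := mingroupP minM.
have nMG: M <| G / K by rewrite /normal sMG.
have [N eM sKN nNG] := inv_quotientN nKG nMG.
exists N; rewrite -eM; split=> //; rewrite properE sKN /=.
apply: contra ntM => sNK; rewrite eM -subG1 quotient_sub1 //.
exact: subset_trans (normal_sub nNG) nKG'.
Qed.

Lemma chief_min (gT : finGroupType) (G K N X : {group gT}) :
  K <| G -> minnormal (N / K) (G / K) -> N <| G -> K \subset N ->
  X <| G -> K \subset X -> X \subset N -> X :=: K \/ X :=: N.
Proof.
move=> nKG /mingroupP[_ minN] nNG sKN nXG sKX sXN.
have nKX: X \subset 'N(K) := subset_trans (normal_sub nXG) (normal_norm nKG).
have [XK1 | ntXK] := eqVneq (X / K) 1.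
  left; apply/eqP; rewrite eqEsubset sKX andbT -quotient_sub1 //.
  by rewrite XK1.
right; apply: (@quotient_inj _ K).
- by rewrite /normal sKX.
- by rewrite /normal sKN (subset_trans (normal_sub nNG) (normal_norm nKG)).
apply: minN; rewrite ?quotientS // ntXK.
by rewrite quotient_norms // normal_norm.
Qed.

Lemma maximal_joing (gT : finGroupType) (G H X : {group gT}) :
  maximal H G -> X \subset G -> ~~ (X \subset H) -> X <*> H = G.
Proof.
case/maxgroupP=> /proper_sub sHG maxH sXG; apply: contraNeq => neXH.
rewrite -(maxH (X <*> H)%G _ (joing_subr _ _)) ?joing_subl //.
by rewrite properEneq neXH join_subG sXG.
Qed.

Lemma mul_normal_maximal (gT : finGroupType) (G H N : {group gT}) :
  maximal H G -> N <| G -> ~~ (N \subset H) -> N * H = G.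
Proof.
move=> maxH nNG nsNH; have sHG: H \subset G by case/maxgroupP: maxH => /proper_sub.
rewrite -norm_joinEr ?(subset_trans sHG) ?normal_norm //.
exact: maximal_joing maxH (normal_sub nNG) nsNH.
Qed.

(** Let K be the core. R_q(H) is normal in [G], so it lies in K, and G = NH puts R_q(G) inside [N].
    If R_q(G) is not inside [H], then R_q(G)K = N, so [N] has a normal subgroup of index [q] over K.
    It contains the derived subgroup of [N], so N/K is abelian of order divisible by [q], which is
    excluded. *)
Lemma resid_maximal (gT : finGroupType) (G H N : {group gT}) q :
  prime q -> maximal H G -> N <| G -> gcore H G \proper N ->
  minnormal (N / gcore H G) (G / gcore H G) ->
  ~~ (abelian (N / gcore H G) && (q %| #|N : gcore H G|)) ->
  G \subset 'N(resid q H) -> resid q G = resid q H.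
Proof.
move=> q_pr maxH nNG pKN minN nab nRG.
have sHG: H \subset G by case/maxgroupP: maxH => /proper_sub.
have nKG: gcore H G <| G := gcore_normal sHG.
have sKN := proper_sub pKN.
have sRK: resid q H \subset gcore H G by rewrite gcore_max ?resid_sub.
have nsNH: ~~ (N \subset H).
  by apply: contra (proper_subn pKN) => sNH; rewrite gcore_max ?normal_norm.
have eNH: N * H = G by apply: mul_normal_maximal.
have sRN: resid q G \subset N.
  apply: subset_trans (resid_mul q nNG sHG eNH) _.
  by rewrite mul_subG // (subset_trans sRK).
have [sRH | nsRH] := boolP (resid q G \subset H); first exact: resid_eq_of_norm.
have nXG: resid q G <*> gcore H G <| G by rewrite normalY ?resid_normal.
have nKN: N \subset 'N(gcore H G).
  exact: subset_trans (normal_sub nNG) (normal_norm nKG).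
case: (chief_min nKG minN nNG sKN nXG (joing_subr _ _)) => /=.
- by rewrite join_subG sRN.
- move=> eX; case/negP: nsRH; apply: subset_trans (gcore_sub H G).
  by rewrite -eX joing_subl.
move=> eX; have nKN': gcore H G <| N by rewrite /normal sKN.
have sNRK: N \subset resid q N * gcore H G.
  rewrite -{1}eX /= norm_joinEl ?(subset_trans sRN) //.
  by rewrite mulSg // sub_resid_resid // normal_sub.
have [M [nMN sKM iM]] := resid_normal_index q_pr nKN' sNRK pKN.
have sN'M: N^`(1) \subset M.
  rewrite der1_min ?normal_norm // cyclic_abelian // prime_cyclic //.
  by rewrite card_quotient ?normal_norm // iM.
have nYG: N^`(1) <*> gcore H G <| G by rewrite normalY // gFnormal_trans.
case: (chief_min nKG minN nNG sKN nYG (joing_subr _ _)) => /=.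
- by rewrite join_subG sKN der_sub.
- move=> eY; case/negP: nab; rewrite -iM indexgS // andbT.
  by apply: sub_der1_abelian; rewrite /= -eY joing_subl.
move=> eY; have sNM: N \subset M by rewrite -eY join_subG sN'M.
by have := prime_gt1 q_pr; rewrite -iM (eqP (_ : #|N : M| == 1)%N) // indexg_eq1.
Qed.

Lemma mem_cycle_sqr (gT : finGroupType) (y : gT) : odd #[y] -> y \in <[y ^+ 2]>.
Proof.
move=> oy; apply/cycleP; exists (#[y].+1)./2; rewrite -expgM mul2n.
by rewrite even_halfK /= ?oy // expgSr expg_order mul1g.
Qed.

Lemma norm_maximal (gT : finGroupType) (G H : {group gT}) (X : {set gT}) g :
  maximal H G -> g \in G -> g \notin H -> H \subset 'N(X) -> g \in 'N(X) ->
  G \subset 'N(X).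
Proof.
move=> maxH Gg nHg nXH nXg; rewrite -(@maximal_joing _ G H <[g]>%G maxH).
- by rewrite join_subG nXH cycle_subG nXg.
- by rewrite cycle_subG.
- by rewrite cycle_subG.
Qed.

(** * Double cosets and the index of [H :&: H :^ g] *)

Lemma card_dcoset (gT : finGroupType) (H : {group gT}) g :
  #|(H :* g) * H| = (#|H : H :&: H :^ g| * #|H|)%N.
Proof.
have ->: (H :* g) * H = g *: (H :^ g * H).
  by rewrite conjsgE !mulgA mulg_set1 mulgV -set1gE mul1g.
rewrite card_lcoset; apply/eqP.
rewrite -(eqn_pmul2r (cardG_gt0 (H :&: H :^ g))) /=.
have := mul_cardG (H :^ g)%G H; rewrite /= cardJg setIC => <-.
by rewrite mulnAC (mulnC #|H : _|) Lagrange ?subsetIl.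
Qed.

Section DoubleCosets.

Variables (gT : finGroupType) (G H : {group gT}) (g : gT).
Hypotheses (sHG : H \subset G) (Gg : g \in G) (nHg : g \notin H).

Lemma dcoset_subD : (H :* g) * H \subset G :\: H.
Proof.
apply/subsetP=> _ /mulsgP[_ b /rcosetP[a Ha ->] Hb ->].
rewrite inE groupMr // groupMl // nHg.
by rewrite !groupM // (subsetP sHG).
Qed.

Lemma index_conj_lt : #|H : H :&: H :^ g| < #|G : H|.
Proof.
have := subset_leq_card dcoset_subD; rewrite card_dcoset cardsD (setIidPr sHG).
rewrite -(Lagrange sHG) -[X in _ - X]muln1 -mulnBr mulnC leq_pmul2l //.
by case: #|G : H| (indexg_gt0 G H) => // n _; rewrite subn1.
Qed.

(** HgH and its inverse have the same size and both avoid [H]; if they met, some [t] outside [H]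
    would have its square in [H]. *)
Lemma index_conj_half : {in G, forall t, t ^+ 2 \in H -> t \in H} ->
  #|H : H :&: H :^ g|.*2 < #|G : H|.
Proof.
move=> sqrH; set D := (H :* g) * H.
have sD : D :|: D^-1 \subset G :\: H.
  rewrite subUset dcoset_subD; apply/subsetP=> x; rewrite inE => Dx.
  by have:= subsetP dcoset_subD _ Dx; rewrite !inE !groupV.
have dD : D :&: D^-1 = set0.
  apply/setP=> x; rewrite !inE; apply/negP=> /andP[Dx Dx'].
  have /setDP[Gx nHx] := subsetP dcoset_subD _ Dx.
  case/mulsgP: Dx => _ b /rcosetP[a Ha ->] Hb xE.
  case/mulsgP: Dx' => _ d /rcosetP[c Hc ->] Hd x'E.
  have gE : g = a^-1 * x * b^-1 by rewrite xE !mulgA mulVg mul1g mulgK.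
  (* Comparing x = agb with x^-1 = cgd gives h x = x^-1 h' for h = c a^-1 and some h' in [H]. Hence
     t = x h satisfies t^2 = h' h. *)
  pose t := x * (c * a^-1).
  have t2 : t ^+ 2 = (b^-1 * d)^-1 * (c * a^-1).
    have sx : c * a^-1 * x = x^-1 * (b^-1 * d)^-1.
      by apply: (mulIg (b^-1 * d)); rewrite mulgKV x'E gE !mulgA.
    by rewrite expgS expg1 /t -mulgA (mulgA _ x) sx !mulgA mulgV mul1g.
  have: t \in H.
    apply: sqrH; first by rewrite !groupM ?groupV // (subsetP sHG).
    by rewrite t2 !(groupM, groupV).
  by rewrite groupMr ?(negPf nHx) // groupM ?groupV.
have := subset_leq_card sD; rewrite cardsU dD cards0 subn0 card_invg addnn.
rewrite card_dcoset cardsD (setIidPr sHG) -(Lagrange sHG).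
rewrite -[X in _ - X]muln1 -mulnBr doubleMl mulnC leq_pmul2l //.
by case: #|G : H| (indexg_gt0 G H) => // n _; rewrite subn1.
Qed.

End DoubleCosets.

(** * Logarithmic bounds and induction on the index *)

Lemma size_primes_trunc_log n : size (primes n) <= trunc_log 2 n.
Proof.
case: n => // n; apply: trunc_log_max => //.
rewrite [X in _ <= X](prod_prime_decomp (ltn0Sn n)).
have: all (fun f => 2 <= f.1 ^ f.2)%N (prime_decomp n.+1).
  apply/allP=> f; rewrite prime_decompE => /mapP[p].
  move=> pn -> /=; have p_pr: prime p by move: pn; rewrite mem_primes => /andP[].
  rewrite (leq_trans (prime_gt1 p_pr)) // -{1}(expn1 p) leq_exp2l ?prime_gt1 //.
  by rewrite logn_gt0.
rewrite /primes size_map.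
elim: (prime_decomp n.+1) => [|f s IHs] /=; first by rewrite big_nil.
by case/andP=> f2 /IHs le_s; rewrite big_cons expnS leq_mul.
Qed.

Lemma trunc_log_sqr_mul a b : 0 < a -> 0 < b ->
  trunc_log 2 a ^ 2 + trunc_log 2 b ^ 2 <= trunc_log 2 (a * b) ^ 2.
Proof.
move=> a0 b0; apply: (@leq_trans ((trunc_log 2 a + trunc_log 2 b) ^ 2)).
  by rewrite sqrnD leq_addr.
by rewrite leq_sqr trunc_log_max // expnD leq_mul ?trunc_logP.
Qed.

(** The price of one induction step: with L = [trunc_log 2 n], halving the index leaves at most (L -
    1)^2, and L + (L - 1)^2 <= L^2 when L > 0. *)
Lemma trunc_log_sqr_half l m n : m.*2 <= n -> 0 < n -> l <= trunc_log 2 n ->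
  l + trunc_log 2 m ^ 2 <= trunc_log 2 n ^ 2.
Proof.
move=> hm; have [n1 | n1 _ le_l] := leqP n 1.
  move=> n_gt0; have -> : n = 1%N by apply/eqP; rewrite eqn_leq n1.
  case: m hm => [|m] hm; last by have := leq_trans hm n1.
  by rewrite trunc_log1 trunc_log0 addn0.
have le_m: trunc_log 2 m <= (trunc_log 2 n).-1.
  by rewrite (trunc_log2S n1) /= leq_trunc_log // -(doubleK m) half_leq.
have: 0 < trunc_log 2 n by rewrite trunc_log_gt0.
case: (trunc_log 2 n) le_l le_m => // k le_l le_m _.
apply: leq_trans (leq_add le_l (_ : _ <= k ^ 2)) _; first by rewrite leq_sqr.
by rewrite -!mulnn mulSn leq_add2l leq_mul2l leqnSn orbT.
Qed.

(** An intermediate maximal subgroup splits the pair into two of smaller index. For a maximal pair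
    the induction hypothesis covers every pair of smaller index, in particular [H] over a subgroup
    [J] of [H]. *)
Lemma index_ind (gT : finGroupType) (P : {group gT} -> {group gT} -> Prop) :
  (forall G : {group gT}, P G G) ->
  (forall G M H : {group gT}, H \subset M -> M \subset G ->
     P G M -> P M H -> P G H) ->
  (forall G H : {group gT}, maximal H G ->
     (forall K L : {group gT}, L \subset K -> #|K : L| < #|G : H| -> P K L) ->
     P G H) ->
  forall G H : {group gT}, H \subset G -> P G H.
Proof.
move=> P_refl P_trans P_max G H; have [m] := ubnP #|G : H|.
elim: m G H => // m IHm G H; rewrite ltnS => le_m sHG.
have IH (K L : {group gT}) : L \subset K -> #|K : L| < #|G : H| -> P K L.
  by move=> sLK lt_i; apply: IHm sLK; apply: leq_trans lt_i le_m.
case: (maximal_exists sHG) => [/val_inj-> // | [M maxM sHM]].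
have [pMG _] := maxgroupP maxM; have sMG := proper_sub pMG.
have [sMH | nsMH] := boolP (M \subset H).
  have eMH : M = H by apply/val_inj/eqP; rewrite eqEsubset sMH.
  by rewrite eMH in maxM; apply: P_max.
have iGH : (#|G : M| * #|M : H|)%N = #|G : H| := Lagrange_index sMG sHM.
apply: (P_trans G M H) => //; apply: IH => //; rewrite -iGH.
  by rewrite ltn_Pmulr ?indexg_gt0 // indexg_gt1.
by rewrite ltn_Pmull ?indexg_gt0 // indexg_gt1 proper_subn.
Qed.

(** * Subgroups containing all 2-elements *)

(** The 2-part of [t] lies in [H] by assumption; the 2'-part is a power of its own square, which is
    a power of [t ^+ 2]. *)
Lemma sqr_mem_of_2elts (gT : finGroupType) (G H : {group gT}) :
  {in G, forall t, 2.-elt t -> t \in H} -> {in G, forall t, t ^+ 2 \in H -> t \in H}.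
Proof.
move=> H2 t Gt Ht2; rewrite -(consttC 2 t).
have sub_cycle (K : {group gT}) (x y : gT) : x \in <[y]> -> y \in K -> x \in K.
  by move=> xy Ky; apply: subsetP xy; rewrite cycle_subG.
have Gc pi : t.`_pi \in G by apply: sub_cycle (cycle_constt pi t) Gt.
apply: groupM; first exact: H2 (Gc _) (p_elt_constt _ _).
apply: (sub_cycle _ _ _ (mem_cycle_sqr _)).
  by rewrite odd_2'nat; exact: p_elt_constt.
by apply: (sub_cycle _ _ _ _ Ht2); rewrite -consttX cycle_constt.
Qed.

(** The condition on [q] amounts to [q] not dividing the index of the core of [H] in [G]. *)
Lemma odd_cover (gT : finGroupType) (G H : {group gT}) :
  H \subset G -> {in G, forall t, 2.-elt t -> t \in H} ->
  exists2 s : seq nat, size s <= trunc_log 2 #|G : H| ^ 2 &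
    forall q, prime q -> q \notin s -> {in G, forall x, q.-elt x -> x \in H}.
Proof.
move: G H; apply: index_ind => [G _ | G M H sHM sMG IHM IHH H2 | G H maxH IH H2].
- by exists [::] => // q _ _ x.
- have [|s1 le1 s1P] := IHM; first by move=> t Gt /(H2 t Gt); apply: subsetP.
  have [|s2 le2 s2P] := IHH; first by move=> t /(subsetP sMG)/H2.
  exists (s1 ++ s2).
    rewrite size_cat -(Lagrange_index sMG sHM).
    by apply: leq_trans (leq_add le1 le2) _; rewrite trunc_log_sqr_mul.
  move=> q q_pr; rewrite mem_cat negb_or => /andP[q1 q2] x Gx qx.
  by apply: (s2P q) => //; apply: (s1P q).
have [pHG _] := maxgroupP maxH; have sHG := proper_sub pHG.
have [_ [g Gg nHg]] := properP pHG; pose J := (H :&: H :^ g)%G.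
have lt_J := index_conj_half sHG Gg nHg (sqr_mem_of_2elts H2).
have [||| s le_s sP] := IH H J; rewrite ?subsetIl //.
- by apply: leq_ltn_trans lt_J; rewrite -addnn leq_addr.
- move=> t Ht t2; rewrite inE Ht mem_conjg H2 ?p_eltJ //.
  by rewrite groupJ ?groupV // (subsetP sHG).
(* Discarding the divisors of |G : H| makes a Sylow [q]-subgroup of [H] Sylow in [G]. *)
exists (primes #|G : H| ++ s).
  rewrite size_cat; apply: leq_trans (leq_add (leqnn _) le_s) _.
  by rewrite trunc_log_sqr_half ?size_primes_trunc_log // ltnW.
move=> q q_pr; rewrite mem_cat negb_or => /andP[q'i qs] x Gx qx.
pose E := <<[set y in H | q.-elt y]>>.
have EH y : y \in H -> q.-elt y -> y \in E by move=> Hy qy; rewrite mem_gen // inE Hy.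
have sEH : E \subset H by rewrite gen_subG; apply/subsetP=> y /[!inE] /andP[].
(* The [q]-elements of [H] all lie in [H :^ g], so conjugation by g^-1 keeps them in [H]. *)
have nEG : G \subset 'N(E).
  apply: (norm_maximal maxH Gg nHg).
    apply: norms_gen; apply/subsetP=> y Hy; rewrite inE.
    by apply/subsetP=> _ /imsetP[z /[!inE] /andP[Hz qz] ->]; rewrite groupJ // p_eltJ.
  rewrite -groupV inE sub_conjgV -genJ gen_subG; apply/subsetP=> y.
  rewrite inE => /andP[Hy qy]; apply: mem_gen; rewrite mem_conjg inE p_eltJ qy andbT.
  by have: y \in J by [apply: (sP q)]; rewrite inE mem_conjg => /andP[].
(* [E] is normal in [G] and contains a Sylow [q]-subgroup of [G], hence all [q]-elements of [G]. *)
have [P /and3P[sPH qP q'P]] := Sylow_exists q H.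
have sylP: q.-Sylow(G) P.
  rewrite /pHall (subset_trans sPH) // qP -(Lagrange_index sHG sPH) pnatM q'P andbT.
  rewrite p'natE //; apply: contra q'i => qi.
  by rewrite mem_primes q_pr indexg_gt0.
have sxG : <[x]> \subset G by rewrite cycle_subG.
have [y Gy sxP] := Sylow_Jsub sylP sxG qx.
rewrite (subsetP sEH) // -(memJ_conjg E y).
rewrite (normsP nEG y Gy).
have: x ^ y \in P by rewrite -cycle_subG cycleJ.
by move=> Pxy; rewrite EH ?(subsetP sPH) // p_eltJ.
Qed.

(** * Maximal subgroups with an abelian chief factor of odd order above the core *)

(** The pair of inverse elements vK, v^-1 K of N/K, merged into one subset so that [H] acts on it by
    conjugation. *)
Definition lcosetUV (gT : finGroupType) (K : {set gT}) (v : gT) :=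
  (v *: K) :|: (v^-1 *: K).

Section AbelianSocle.

Variables (gT : finGroupType) (G H N : {group gT}).
Hypotheses (maxH : maximal H G) (nNG : N <| G).
Let K := gcore H G.
Hypotheses (pKN : K \proper N) (abNK : abelian (N / K)) (oddNK : odd #|N : K|).

Let sHG : H \subset G. Proof. by case/maxgroupP: maxH => /proper_sub. Qed.
Let nKG : K <| G. Proof. exact: gcore_normal. Qed.
Let nK : {in G, forall x, K :^ x = K}.
Proof. by move=> x Gx; apply: (normsP (normal_norm nKG)). Qed.
Let sNG : N \subset G. Proof. exact: normal_sub. Qed.
Let sKN : K \subset N. Proof. exact: proper_sub. Qed.

Let nsNH : ~~ (N \subset H).
Proof. by apply: contra (proper_subn pKN) => sNH; rewrite gcore_max ?normal_norm. Qed.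

Let eNH : N * H = G. Proof. exact: mul_normal_maximal. Qed.

(** As N/K is abelian, [N] normalises [N :&: H]; so does [H], hence so does G = NH. *)
Let capNH : N :&: H = K.
Proof.
apply/eqP; rewrite eqEsubset subsetI sKN gcore_sub !andbT.
rewrite gcore_max ?subsetIr // -eNH mul_subG //.
  apply: normal_norm; apply: (@sub_der1_normal _ N (N :&: H)%G); last exact: subsetIl.
  apply: subset_trans (_ : K \subset _); last by rewrite subsetI sKN gcore_sub.
  by rewrite der1_min // (subset_trans sNG) ?normal_norm.
by rewrite normsI ?normG // (subset_trans sHG) ?normal_norm.
Qed.

Lemma index_socle : #|G : H| = #|N : K|.
Proof.
have nNH : H \subset 'N(N) := subset_trans sHG (normal_norm nNG).
by rewrite -{1}eNH -(normC nNH) indexMg -indexgI capNH.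
Qed.

Local Notation pm := (lcosetUV K).

Let pmJ v x : x \in G -> pm v :^ x = pm (v ^ x).
Proof.
by move=> Gx; rewrite /lcosetUV conjUg !conjsMg !conjg_set1 nK // conjVg.
Qed.

Let lcK u v : u \in v *: K -> u *: K = v *: K.
Proof. by move/lcoset_eqP. Qed.

Let lcKV u v : v \in G -> u \in v *: K -> u^-1 \in v^-1 *: K.
Proof.
move=> Gv /lcosetP[k Kk ->]; rewrite mem_lcoset invgK invMg mulgA.
have -> : v * k^-1 * v^-1 = k^-1 ^ v^-1 by rewrite conjgE invgK mulgA.
by rewrite -(nK (groupVr Gv)) memJ_conjg groupV.
Qed.

Let pm_eq u v : v \in G -> u \in pm v -> pm u = pm v.
Proof.
move=> Gv /setUP[] uv.
  by rewrite /lcosetUV (lcK uv) (lcK (lcKV Gv uv)).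
have := lcKV (groupVr Gv) uv; rewrite invgK => uv'.
by rewrite /lcosetUV (lcK uv) (lcK uv') setUC.
Qed.

Let sqrK v : v \in N -> v ^+ 2 \in K -> v \in K.
Proof.
move=> Nv Kv2; have nKN := subset_trans sNG (normal_norm nKG).
have nKv : v \in 'N(K) := subsetP nKN v Nv.
apply: coset_idr => //.
have v2 : coset K v ^+ 2 = 1 by rewrite -(coset_id Kv2) morphX.
have ov : odd #[coset K v].
  apply: dvdn_odd oddNK; rewrite -card_quotient //.
  by rewrite order_dvdG // mem_quotient.
by have := mem_cycle_sqr ov; rewrite v2 cycle1 inE => /eqP.
Qed.

(** The [H]-conjugates of the pair are disjoint subsets of [N :\: K] of size 2|K|, and |N : K| = |G
    : H|. *)
Lemma index_pm_half g : g \in N -> g \notin K ->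
  #|H : 'N_H(pm g)|.*2 <= #|G : H|.
Proof.
move=> Ng nKg; set P := pm g :^: H.
have GN v : v \in N -> v \in G by move/(subsetP sNG).
have pmP A : A \in P -> exists2 v, v \in N :\: K & A = pm v.
  case/imsetP=> x Hx ->; have Gx := subsetP sHG x Hx.
  exists (g ^ x); last by rewrite pmJ.
  rewrite inE -(nK Gx) memJ_conjg nKg /=.
  by rewrite -(normsP (normal_norm nNG) x Gx) memJ_conjg.
(* The two cosets are distinct because N/K has odd order. *)
have cardP : {in P, forall A : {set gT}, #|A| = #|K|.*2}.
  move=> A /pmP[v /setDP[Nv nKv] ->].
  rewrite /lcosetUV cardsU !card_lcoset addnn (_ : _ :&: _ = set0) ?cards0 ?subn0 //.
  apply/setP=> u; rewrite !inE; apply/negP=> /andP[/lcK uv /lcK uv'].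
  have: v \in v^-1 *: K by rewrite -uv' uv lcoset_refl.
  by rewrite mem_lcoset invgK => /(sqrK Nv); apply/negP.
have trivP : trivIset P.
  apply/trivIsetP=> A B /pmP[v /setDP[Nv _] ->] /pmP[w /setDP[Nw _] ->].
  apply: contraR => /pred0Pn[u /andP[/= uv uw]].
  by rewrite -(pm_eq (GN _ Nv) uv) (pm_eq (GN _ Nw) uw).
have coverP : cover P \subset N :\: K.
  apply/bigcupsP=> A /pmP[v /setDP[Nv nKv] ->]; rewrite /lcosetUV.
  have sub w : w \in N -> w \notin K -> w *: K \subset N :\: K.
    move=> Nw nKw; apply/subsetP=> _ /lcosetP[k Kk ->].
    by rewrite inE groupMr // nKw groupM // (subsetP sKN).
  by rewrite subUset !sub ?groupV.
have := subset_leq_card coverP.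
have partP : partition P (cover P).
  rewrite /partition eqxx trivP; apply/negP=> /cardP/eqP.
  by rewrite cards0 eq_sym double_eq0 -leqn0 leqNgt cardG_gt0.
rewrite (card_uniform_partition cardP partP) card_conjugates.
rewrite cardsD (setIidPr sKN) -(Lagrange sKN) index_socle -doubleMr doubleMl.
rewrite -[X in _ - X]muln1 -mulnBr mulnC leq_pmul2l // => le_i.
by apply: leq_trans le_i _; apply: leq_subr.
Qed.

(** R_q(H) fixes the coset gK, so [R_q(H), g] lies in [K] and R_q(H)K is normalised by both [H] and
    [g]. It is thus normal in [G] and lies in the core [K], whence R_q(H) = R_q(K). *)
Lemma resid_abelian_socle g q : prime q -> odd q -> g \in N -> g \notin K ->
  resid q H \subset 'N_H(pm g) -> G \subset 'N(resid q H).
Proof.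
move=> q_pr q_odd Ng nKg sRJ; have Gg := subsetP sNG g Ng.
have nHg : g \notin H.
  by apply: contra nKg => Hg; rewrite -capNH inE Ng.
have fixR : resid q H \subset 'N(g *: K).
  apply: subset_trans (resid_gen_pelt H q_pr) _; rewrite gen_subG.
  apply/subsetP=> r /setIdP[Rr qr].
  have Gr : r \in G := subsetP sHG r (subsetP (resid_sub q H) r Rr).
  have gKJ v : v \in G -> (v *: K) :^ r = v ^ r *: K.
    by move=> Gv; rewrite conjsMg conjg_set1 nK.
  have [_ /normP pmr] := setIP (subsetP sRJ r Rr).
  have : g ^ r \in pm g by rewrite -pmr memJ_conjg inE lcoset_refl.
  case/setUP=> [/lcK gr | gr]; first by apply/normP; rewrite gKJ.
  (* If [r] swaps the two cosets, its square fixes both, and [r] has odd order. *)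
  have rcr : r \in <[r ^+ 2]>.
    apply: mem_cycle_sqr; rewrite odd_2'nat; apply: sub_in_pnat qr => p _.
    by move/eqnP->; rewrite !inE; apply: contraTneq q_odd => ->.
  apply: (subsetP _ r rcr); rewrite cycle_subG; apply/normP.
  rewrite expgS expg1 conjsgM gKJ // (lcK gr) gKJ ?groupV // conjVg.
  by apply: lcK; have := lcKV (groupVr Gg) gr; rewrite invgK.
have nRK : G \subset 'N(resid q H <*> K).
  apply: (norm_maximal maxH Gg nHg).
    rewrite normsY ?(normal_norm (resid_normal _ _)) //.
    exact: subset_trans sHG (normal_norm nKG).
  rewrite inE conjYg nK // join_subG joing_subr andbT.
  apply/subsetP=> _ /imsetP[r Rr ->].
  have : g ^ r^-1 \in g *: K.
    by rewrite -(normP (subsetP fixR _ (groupVr Rr))) memJ_conjg lcoset_refl.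
  rewrite mem_lcoset => Kk.
  have -> : r ^ g = (g^-1 * g ^ r^-1) * r by rewrite !conjgE invgK !mulgA mulgKV.
  by rewrite groupM // ?(subsetP (joing_subl _ _) r) // (subsetP (joing_subr _ _)).
have sRK : resid q H \subset K.
  apply: subset_trans (joing_subl _ K) (gcore_max _ nRK).
  by rewrite join_subG resid_sub gcore_sub.
suffices -> : resid q H = resid q K.
  by apply: subset_trans (normal_norm nKG) (norm_resid q _).
apply/eqP; rewrite eqEsubset sub_resid_resid ?gcore_sub //=.
apply: resid_subnormal; apply: normal_subnormal.
exact: normalS (gcore_sub _ _) sHG nKG.
Qed.

End AbelianSocle.

(** * Equality of residuals outside a small set of primes *)

(** The subgroup [S] is normal in [G], lies in [H] and contains both residuals, so R_q(H) <= R_q(S)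
    <= R_q(G). *)
Lemma resid_eq_of_pelts (gT : finGroupType) (G H : {group gT}) q :
  prime q -> H \subset G -> {in G, forall x, q.-elt x -> x \in H} ->
  resid q G = resid q H.
Proof.
move=> q_pr sHG GqH; pose S := <<[set x in G | q.-elt x]>>%G.
have sSH : S \subset H by rewrite gen_subG; apply/subsetP=> x /setIdP[Gx /GqH->].
have nSG : S <| G.
  rewrite /normal (subset_trans sSH) //; apply: norms_gen.
  apply/subsetP=> x Gx; rewrite inE; apply/subsetP=> _ /imsetP[y /setIdP[Gy qy] ->].
  by rewrite inE groupJ // p_eltJ.
have sub_S (X : {group gT}) : X \subset G -> resid q X \subset S.
  move=> sXG; apply: subset_trans (resid_gen_pelt _ q_pr) (genS _).
  apply/subsetP=> x /setIdP[Rx qx]; rewrite inE qx andbT.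
  exact: subsetP (subset_trans (resid_sub q X) sXG) x Rx.
apply/eqP; rewrite eqEsubset sub_resid_resid //=; last first.
  exact: subset_trans (sub_S G (subxx _)) sSH.
apply: subset_trans (resid_subnormal q (normal_subnormal nSG)).
by rewrite sub_resid_resid ?sub_S.
Qed.

Lemma exists_sqr_mem (gT : finGroupType) (H : {group gT}) t :
  2.-elt t -> t \notin H -> exists2 u, u \in <[t]> & (u \notin H) && (u ^+ 2 \in H).
Proof.
move=> t2 nHt; have [k ot] := p_natP t2.
have ex_k : exists k, t ^+ (2 ^ k) \in H.
  by exists k; rewrite -ot expg_order group1.
case: (ex_minnP ex_k) => -[|j]; first by rewrite expn0 expg1 (negPf nHt).
move=> Hj min_j; exists (t ^+ (2 ^ j)); first exact: mem_cycle.
rewrite -expgM -expnSr Hj andbT; apply/negP=> /min_j.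
by rewrite ltnn.
Qed.

Lemma abelian_chief_pgroup (gT : finGroupType) (M G : {group gT}) :
  minnormal M G -> abelian M -> exists2 p : nat, prime p & p.-group M.
Proof.
move=> minM abM.
have [_ _ /is_abelemP[p p_pr abelM]] :=
  minnormal_solvable minM (subxx _) (abelian_sol abM).
by exists p => //; apply: abelem_pgroup abelM.
Qed.

Lemma resid_cover (gT : finGroupType) (G H : {group gT}) :
  H \subset G -> exists2 s : seq nat, size s <= trunc_log 2 #|G : H| ^ 2 &
    forall q, prime q -> odd q -> q \notin s -> resid q G = resid q H.
Proof.
move: G H; apply: index_ind => [G | G M H sHM sMG [s1 le1 s1P] [s2 le2 s2P] |].
- by exists [::].
- exists (s1 ++ s2).
    rewrite size_cat -(Lagrange_index sMG sHM).
    by apply: leq_trans (leq_add le1 le2) _; rewrite trunc_log_sqr_mul.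
  move=> q q_pr q_odd; rewrite mem_cat negb_or => /andP[q1 q2].
  by rewrite s1P ?s2P.
move=> G H maxH IH.
have [pHG _] := maxgroupP maxH; have sHG := proper_sub pHG.
have nKG : gcore H G <| G := gcore_normal sHG.
have [N [nNG pKN minN]] :=
  chief_exists nKG (sub_proper_trans (gcore_sub H G) pHG).
have nKN : N \subset 'N(gcore H G).
  exact: subset_trans (normal_sub nNG) (normal_norm nKG).
have i_gt1 : 1 < #|G : H| by rewrite indexg_gt1 proper_subn.
have [/andP[abN oddN] | not_ab_odd] :=
  boolP (abelian (N / gcore H G) && odd #|N : gcore H G|).
  have [_ [g Ng nKg]] := properP pKN.
  pose J := ('N_H(lcosetUV (gcore H G) g))%G.
  have le_J : #|H : J|.*2 <= #|G : H|.
    exact: index_pm_half Ng nKg.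
  have lt_J : #|H : J| < #|G : H|.
    by apply: leq_trans le_J; rewrite -addnn -addn1 leq_add2l indexg_gt0.
  have [||s le_s sP] := IH H J; rewrite ?subsetIl //.
  have [p p_pr pN] := abelian_chief_pgroup minN abN.
  (* Only the prime [p] of the chief factor is added, and the halved index pays for it. *)
  exists (p :: s).
    apply: leq_trans (_ : 1 + trunc_log 2 #|H : J| ^ 2 <= _)%N => //.
    by rewrite trunc_log_sqr_half // ?trunc_log_gt0 // ltnW.
  move=> q q_pr q_odd; rewrite inE negb_or => /andP[neqp qs].
  apply: resid_maximal (minN) _ _ => //.
    rewrite abN -card_quotient //; apply: contra neqp.
    by move/(pgroupP pN q q_pr).
  apply: (resid_abelian_socle maxH nNG pKN abN q_pr q_odd Ng nKg).
  by rewrite (sP q q_pr q_odd qs) resid_sub.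
have [H2 | ] := boolP [forall t in G, (2.-elt t) ==> (t \in H)].
  have H2' : {in G, forall t, 2.-elt t -> t \in H}.
    by move=> t Gt; apply: implyP (forall_inP H2 t Gt).
  have [s le_s sP] := odd_cover sHG H2'; exists s => // q q_pr _ qs.
  by apply: resid_eq_of_pelts => //; apply: sP.
case/forall_inPn=> t0 Gt0; rewrite negb_imply => /andP[t02 nHt0].
have [t tt0 /andP[nHt Ht2]] := exists_sqr_mem t02 nHt0.
have Gt : t \in G by apply: subsetP tt0; rewrite cycle_subG.
pose J := (H :&: H :^ t)%G.
have lt_J : #|H : J| < #|G : H| := index_conj_lt sHG Gt nHt.
have [||s le_s sP] := IH H J; rewrite ?subsetIl //.
exists s.
  by apply: leq_trans le_s _; rewrite leq_sqr leq_trunc_log // ltnW.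
move=> q q_pr q_odd qs; apply: resid_maximal (minN) _ _ => //.
  (* An abelian N/K of order divisible by the odd prime [q] is a [q]-group of odd order, the case
     already treated. *)
  apply: contra not_ab_odd => /andP[abN qN]; rewrite abN /=.
  have [p p_pr pN] := abelian_chief_pgroup minN abN.
  rewrite -card_quotient // in qN *.
  have eqp : q = p by apply/eqP; apply: (pgroupP pN).
  rewrite odd_2'nat; apply: sub_in_pnat pN => r _ /eqnP->.
  by rewrite !inE -eqp; apply: contraTneq q_odd => ->.
(* Since [t ^+ 2] is in [H], [t] swaps [H] and [H :^ t], so it normalises [J] and R_q(J) =
   R_q(H). *)
apply: (norm_maximal maxH Gt nHt); first exact: normal_norm (resid_normal _ _).
rewrite (sP q q_pr q_odd qs); apply: (subsetP (norm_resid q J)).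
by apply/normP; rewrite /= conjIg -conjsgM -[t * t]/(t ^+ 2) (conjGid Ht2) setIC.
Qed.

(** * Composition factors of point stabilisers *)

Lemma comp_factor_resid (gT : finGroupType) (H : {group gT}) p :
  has_abelian_comp_factor H p -> prime p /\ resid p H :!=: 1.
Proof.
case=> s [/andP[_ cs] [i lt_is [abBA oBA]]].
set B := nth H (H :: s) i in abBA oBA; set A := nth H (H :: s) i.+1 in abBA oBA.
have maxs j : j < size s -> maxnormal (nth H s j) (nth H (H :: s) j) (nth H (H :: s) j).
  by move=> lt_js; have /(pathP H)/(_ j lt_js) := cs.
have sub_s j : j <= size s -> nth H (H :: s) j <|<| H.
  elim: j => [|j IHj] lt_js; first exact: subnormal_refl.
  apply: subnormal_trans (IHj (ltnW lt_js)).
  exact: normal_subnormal (maxnormal_normal (maxs j lt_js)).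
have nAB : A <| B := maxnormal_normal (maxs i lt_is).
have p_pr : prime p.
  rewrite -oBA; apply: simple_sol_prime (abelian_sol abBA) _.
  by rewrite quotient_simple //; apply: (maxs i).
split=> //; apply: resid_ntriv p_pr (sub_s i (ltnW lt_is)) (nAB) _.
by rewrite -oBA card_quotient //; apply: normal_norm nAB.
Qed.

Lemma perm_corefree (T : finType) (G R : {group {perm T}}) (x : T) :
  [transitive G, on [set: T] | 'P] -> R \subset 'C_G[x | 'P] ->
  G \subset 'N(R) -> R :==: 1.
Proof.
move=> trG /subsetIP[sRG sRx] nRG; rewrite -subG1.
apply: subset_trans (aperm_faithful G); rewrite subsetI sRG.
by rewrite (astab_trans_gcore trG (in_setT x)) gcore_max.
Qed.

Lemma card_CompA_le (T : finType) (G : {group {perm T}}) (x : T) :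
  [transitive G, on [set: T] | 'P] ->
  #|CompA 'C_G[x | 'P]| <= (trunc_log 2 #|T| ^ 2).+1.
Proof.
move=> trG; have sHG : 'C_G[x | 'P] \subset G := subsetIl _ _.
have iGH : #|G : 'C_G[x | 'P]| = #|T|.
  by rewrite -card_orbit (atransP trG) ?inE // cardsT.
have [s] := @resid_cover _ G 'C_G[x | 'P]%G sHG.
(* [resid_cover] speaks of odd primes only, so 2 is added by hand; this is the extra 1 in the
   bound. *)
rewrite iGH => le_s sP; apply: leq_trans (_ : size (2%N :: s) <= _); last by [].
rewrite cardE -(size_map val); apply: uniq_leq_size.
  by rewrite map_inj_uniq ?enum_uniq //; apply: val_inj.
move=> _ /mapP[q + ->]; rewrite mem_enum inE => /asboolP.
case/comp_factor_resid=> q_pr ntR; rewrite inE.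
have [q2 | q_odd] := even_prime q_pr; first by apply/orP; left; apply/eqP.
apply: contraR ntR; rewrite negb_or => /andP[_ qs].
apply: (@perm_corefree _ G _ x) => //; first exact: resid_sub.
by have := normal_norm (resid_normal q G); rewrite (sP q q_pr q_odd qs).
Qed.

(** For degree 2 the bound of [card_CompA_le] equals 2(log 2)^2 and is not strict, but here the
    stabiliser is trivial. *)
Lemma CompA_degree2 (T : finType) (G : {group {perm T}}) (x : T) :
  [transitive G, on [set: T] | 'P] -> #|T| = 2%N -> #|CompA 'C_G[x | 'P]| = 0%N.
Proof.
move=> trG T2; have sHG : 'C_G[x | 'P] \subset G := subsetIl _ _.
have H1 : #|'C_G[x | 'P]| = 1%N.
  apply/eqP; rewrite eqn_leq cardG_gt0 andbT.
  rewrite -(@leq_pmul2r 2) // mul1n -{1}T2 -cardsT -(atransP trG x (in_setT x)).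
  rewrite mulnC card_orbit_stab.
  apply: leq_trans (_ : #|perm_on [set: T]| <= _); last by rewrite card_perm cardsT T2.
  by apply: subset_leq_card; apply/subsetP=> y _; apply/subsetP=> z; rewrite inE.
apply/eqP; rewrite cards_eq0; apply/eqP/setP=> q; rewrite !inE.
apply/asboolP=> /comp_factor_resid[_] /negP[].
by rewrite -subG1 (subset_trans (resid_sub _ _)) // subG1 trivg_card1 H1.
Qed.

(** * Passage to real logarithms *)

Lemma trunc_log_le_log2 n : 0 < n -> Rle (INR (trunc_log 2 n)) (log2 (INR n)).
Proof.
move=> n_gt0; have /leP/le_INR le_n : 2 ^ trunc_log 2 n <= n by apply: trunc_logP.
have ln2_gt0 : Rlt 0 (ln 2) by rewrite -ln_1; apply: ln_increasing; lra.
have pow2 k : INR (2 ^ k) = pow 2 k.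
  by elim: k => [|k IHk]; rewrite ?expnS ?mult_INR ?IHk.
rewrite pow2 in le_n; have pow_gt0 : Rlt 0 (pow 2 (trunc_log 2 n)).
  by apply: pow_lt; lra.
apply: (Rmult_le_reg_r _ _ _ ln2_gt0).
rewrite /log2 /Rdiv Rmult_assoc Rinv_l; last lra.
rewrite Rmult_1_r -ln_pow; last lra.
by case: le_n => [lt_n | ->]; [left; apply: ln_increasing | right].
Qed.

Lemma log2_gt1 n : 2 < n -> Rlt 1 (log2 (INR n)).
Proof.
move/ltP/lt_INR => /= lt_n; have ln2_gt0 : Rlt 0 (ln 2).
  by rewrite -ln_1; apply: ln_increasing; lra.
apply: (Rmult_lt_reg_r _ _ _ ln2_gt0).
rewrite /log2 /Rdiv Rmult_assoc Rinv_l; last lra.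
by rewrite Rmult_1_r Rmult_1_l; apply: ln_increasing; lra.
Qed.

Theorem theorem7 (T : finType) (n : nat) (G : {group {perm T}}) (x : T) :
  #|T| = n -> (1 < n)%N ->
  [transitive G, on [set: T] | 'P] ->
  (Rlt (INR #|CompA 'C_G[x | 'P]|) (Rmult 2 (pow (log2 (INR n)) 2))).
Proof.
move=> Tn n_gt1 trG; case: (ltngtP n 2) => [| n_gt2 | n2].
- by rewrite ltnNge n_gt1.
(* With L = log n > 1, the bound L^2 + 1 is below 2 L^2. *)
- have /leP/le_INR := card_CompA_le x trG; rewrite Tn S_INR -mulnn mult_INR.
  have := trunc_log_le_log2 (ltnW n_gt1); have := log2_gt1 n_gt2.
  have := pos_INR (trunc_log 2 n).
  set l := INR (trunc_log 2 n); set L := log2 _; set c := INR _.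
  by rewrite /= Rmult_1_r => *; nra.
rewrite (CompA_degree2 x trG) ?Tn // n2 /log2 /Rdiv.
have -> : INR 2 = IZR 2 by rewrite /=; lra.
have ln2_gt0 : Rlt 0 (ln 2) by rewrite -ln_1; apply: ln_increasing; lra.
rewrite Rinv_r /=; lra.
Qed.
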